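(* Let $A_2=\{(x_0,x_1,x_2)\in\mathbb{Z}^3 : x_0+x_1+x_2=0\}$, regarded as a lattice in the $2$-dimensional Euclidean plane $V=\{x\in\mathbb{R}^3: x_0+x_1+x_2=0\}$ with the inner product induced from $\mathbb{R}^3$. For every positive real number $m$ such that the shell $(A_2)_m=\{x\in A_2: \langle x|x\rangle=m\}$ is nonempty, the set $(A_2)_m$ is not a spherical $7$-design in $V$.
   Context: A finite nonempty set $X$ lying on the sphere $S_r=\{x\in V: \langle x|x\rangle=r^2\}$ of a Euclidean space $V$ (with $r>0$) is called a spherical $t$-design if $\frac{1}{|X|}\sum_{x\in X}f(x)=\frac{1}{|S_r|}\int_{S_r}f(x)\,d\sigma(x)$ for all polynomial functions $f$ on $V$ of degree at most $t$, where $d\sigma$ is the surface (arc-length) measure and $|S_r|$ the total measure of $S_r$. *)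

(* Defs.v *)
From HB Require Import structures.
From mathcomp Require Import all_boot all_order all_algebra.
(* The notations of mpoly clash with those of analysis. *)
From mathcomp Require Import -(notations) mpoly.
From mathcomp Require Import finmap.
From mathcomp Require Import all_classical all_reals all_analysis.
Set Implicit Arguments.
Unset Strict Implicit.
Unset Printing Implicit Defensive.
Import Order.TTheory GRing.Theory Num.Theory.
Import numFieldNormedType.Exports.
Local Open Scope classical_set_scope.
Local Open Scope ring_scope.

Definition dot (R : realType) (n : nat) (x y : 'rV[R]_n) : R :=
  \sum_(i < n) x 0 i * y 0 i.

(* The Euclidean norm is spelled out: the library norm on matrices is the
   sup norm. *)
Definition speed (R : realType) (n : nat) (gamma : R -> 'rV[R]_n) (s : R) : R :=
  Num.sqrt (\sum_(i < n) (derive1 (fun u : R => gamma u 0 i) s) ^+ 2).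

Definition arclength_integral (R : realType) (n : nat)
    (gamma : R -> 'rV[R]_n) (a b : R) (f : 'rV[R]_n -> R) : R :=
  \int[lebesgue_measure]_(s in `[a, b]) (f (gamma s) * speed gamma s).

Definition orthonormal_basis2 (R : realType) (n : nat) (V : set 'rV[R]_n)
    (u v : 'rV[R]_n) : Prop :=
  [/\ dot u u = 1, dot v v = 1, dot u v = 0 &
      V = [set x | exists a b : R, x = a *: u + b *: v]].

Definition sphere (R : realType) (n : nat) (V : set 'rV[R]_n) (r : R) :
    set 'rV[R]_n :=
  [set x | V x /\ dot x x = r ^+ 2].

(* One full turn of the sphere of radius r of the plane with orthonormal basis
   (u, v), for s in [0, 2 pi]. *)
Definition circle_param (R : realType) (n : nat) (u v : 'rV[R]_n) (r : R)
    (s : R) : 'rV[R]_n :=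
  (r * cos s) *: u + (r * sin s) *: v.

Definition circle_integral (R : realType) (n : nat) (u v : 'rV[R]_n) (r : R)
    (f : 'rV[R]_n -> R) : R :=
  arclength_integral (circle_param u v r) 0 (2 * pi) f.

(* f is a polynomial function of degree at most t on a subspace V of R^n when
   it is the restriction to V of a polynomial in the n ambient coordinates all
   of whose monomials have degree at most t; every polynomial function on V
   arises so, by composing with the orthogonal projection onto V. *)
Definition polynomial_function (R : realType) (n : nat) (V : set 'rV[R]_n)
    (t : nat) (f : 'rV[R]_n -> R) : Prop :=
  exists2 p : mpoly n R, {in msupp p, forall k, (mdeg k <= t)%N} &
    forall x, V x -> f x = meval (fun i => x 0 i) p.

(* Spherical t-designs in a Euclidean plane V of R^n, so that the surface
   measure of the spheres of V is arc length.  The integrals do not depend on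
   the orthonormal basis used to parametrize the circle. *)
Definition spherical_design (R : realType) (n : nat) (V : set 'rV[R]_n)
    (t : nat) (X : set 'rV[R]_n) : Prop :=
  [/\ finite_set X, X !=set0 &
   exists r : R, [/\ 0 < r, X `<=` sphere V r &
     forall u v : 'rV[R]_n, orthonormal_basis2 V u v ->
     forall f : 'rV[R]_n -> R, polynomial_function V t f ->
       (#|` fset_set X|%:R)^-1 * (\sum_(x \in X) f x) =
       (circle_integral u v r (fun=> 1))^-1 * circle_integral u v r f]].

Definition A2_plane (R : realType) : set 'rV[R]_3 :=
  [set x | \sum_(i < 3) x 0 i = 0].

Definition A2 (R : realType) : set 'rV[R]_3 :=
  [set map_mx intr z | z in [set z : 'rV[int]_3 | \sum_(i < 3) z 0 i = 0]].

Definition A2_shell (R : realType) (m : R) : set 'rV[R]_3 :=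
  [set x | @A2 R x /\ dot x x = m].

(* Main.v *)
Require Import Defs.
From HB Require Import structures.
From mathcomp Require Import all_boot all_order all_algebra.
From mathcomp Require Import -(notations) mpoly.
From mathcomp Require Import finmap.
From mathcomp Require Import all_classical all_reals all_analysis.
From mathcomp Require Import zify ring lra.
Set Implicit Arguments.
Unset Strict Implicit.
Unset Printing Implicit Defensive.
Import Order.TTheory GRing.Theory Num.Theory.
Import numFieldNormedType.Exports.
Local Open Scope classical_set_scope.
Local Open Scope ring_scope.

(* Up to a factor sqrt 2, A2 is the ring of Eisenstein integers, and the trace
   of z ^ 6 is a harmonic polynomial of degree 6, so its mean over a circle is
   0.  It remains to show that S(n), the sum of z ^ 6 over the z of norm n, is
   nonzero as soon as n is a norm.  By induction on n: let p be a prime of norm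
   q dividing an element of norm n.  If p is associate to its conjugate p',
   then S(n) = p ^ 6 S(n / q).  Otherwise write n = q ^ k n', with no element
   of norm n' divisible by p.  Separating the multiples of p in each shell,
   S(q ^ (j + 1) n') = p ^ 6 S(q ^ j n') + p' ^ (6 (j + 1)) S(n'), whence
   S(n) = a S(n') with a congruent to p' ^ (6 k), hence nonzero, modulo p. *)

(** * The ring of Eisenstein integers *)

(* The pair [(a, b)] stands for [a + b * zeta], where [zeta = exp (i pi / 3)]
   satisfies [zeta ^ 2 = zeta - 1]. *)
Definition eisenstein : Type := (int * int)%type.

HB.instance Definition _ := GRing.Zmodule.copy eisenstein (int * int)%type.

Definition emul (x y : eisenstein) : eisenstein :=
  (x.1 * y.1 - x.2 * y.2, x.1 * y.2 + x.2 * y.1 + x.2 * y.2).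

Lemma emulA : associative emul.
Proof.
by move=> [a b] [c d] [e f]; rewrite /emul /=; congr pair; ring.
Qed.

Lemma emulC : commutative emul.
Proof. by move=> [a b] [c d]; rewrite /emul /=; congr pair; ring. Qed.

Lemma emul1 : left_id (1, 0) emul.
Proof. by move=> [a b]; rewrite /emul /=; congr pair; ring. Qed.

Lemma emulD : left_distributive emul +%R.
Proof.
by move=> [a b] [c d] [e f]; rewrite /emul /=; congr pair => /=; ring.
Qed.

Lemma eone_neq0 : (1, 0) != 0 :> eisenstein.
Proof. by []. Qed.

HB.instance Definition _ := GRing.Zmodule_isComNzRing.Build eisenstein
  emulA emulC emul1 emulD eone_neq0.

Implicit Types (x y z w p : eisenstein) (n : int).

Lemma emulE (x y : eisenstein) : x * y =
  (x.1 * y.1 - x.2 * y.2, x.1 * y.2 + x.2 * y.1 + x.2 * y.2).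
Proof. by []. Qed.

Definition enorm (x : eisenstein) : int := x.1 ^+ 2 + x.1 * x.2 + x.2 ^+ 2.

Definition econj (x : eisenstein) : eisenstein := (x.1 + x.2, - x.2).

Lemma enormM x y : enorm (x * y) = enorm x * enorm y.
Proof. by rewrite /enorm /=; ring. Qed.

Lemma enorm1 : enorm 1 = 1. Proof. by []. Qed.

Lemma enormX x k : enorm (x ^+ k) = enorm x ^+ k.
Proof. by elim: k => [|k IH] //; rewrite !exprS enormM IH. Qed.

Lemma enorm_ge0 x : 0 <= enorm x.
Proof. rewrite /enorm; nia. Qed.

Lemma enorm_eq0 x : enorm x = 0 -> x = 0.
Proof.
case: x => a b; rewrite /enorm /= => h.
have -> : a = 0 by nia.
by have -> : b = 0 by nia.
Qed.

Lemma emulf_eq0 x y : x * y = 0 -> x = 0 \/ y = 0.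
Proof.
move/(congr1 enorm); rewrite enormM => /eqP; rewrite mulf_eq0.
by case/orP => /eqP /enorm_eq0; [left | right].
Qed.

Lemma emulfI x : x <> 0 -> injective ( *%R x).
Proof.
move=> x0 y z /eqP; rewrite -subr_eq0 -mulrBr => /eqP /emulf_eq0 [] // /eqP.
by rewrite subr_eq0 => /eqP.
Qed.

Lemma econjM : {morph econj : x y / x * y}.
Proof.
by move=> x y; rewrite /econj emulE /=; congr pair => /=; ring.
Qed.

Lemma econjX x k : econj (x ^+ k) = econj x ^+ k.
Proof. by elim: k => [|k IH] //; rewrite !exprS econjM IH. Qed.

Lemma econjK : involutive econj.
Proof. by case=> a b; rewrite /econj /=; congr pair; ring. Qed.

Lemma enorm_conj x : enorm (econj x) = enorm x.
Proof. by rewrite /enorm /=; ring. Qed.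

Lemma einjE n : n%:~R = (n, 0) :> eisenstein.
Proof.
have natE k : k%:R = (k%:Z, 0) :> eisenstein.
  by elim: k => [|k IH] //; rewrite -natr1 IH -addn1 PoszD.
case: n => k; first by rewrite -pmulrn natE.
by rewrite NegzE mulrNz -pmulrn natE.
Qed.

Lemma emul_conj x : x * econj x = (enorm x)%:~R.
Proof. by rewrite einjE emulE /enorm /=; congr pair; ring. Qed.

(** * Divisibility, Euclidean division and prime divisors *)

Definition edvd x y : Prop := exists z, y = x * z.

Lemma edvd_mulr x y z : edvd x y -> edvd x (y * z).
Proof. by case=> t ->; exists (t * z); rewrite mulrA. Qed.

Lemma edvd_mull x y z : edvd x y -> edvd x (z * y).
Proof. by rewrite mulrC; exact: edvd_mulr. Qed.

Lemma edvdD x y z : edvd x y -> edvd x z -> edvd x (y + z).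
Proof. by move=> [s ->] [t ->]; exists (s + t); rewrite mulrDr. Qed.

Lemma edvd_trans y x z : edvd x y -> edvd y z -> edvd x z.
Proof. by move=> xy [t ->]; exact: edvd_mulr. Qed.

Lemma edvd_conj x y : edvd x y -> edvd (econj x) (econj y).
Proof. by case=> t ->; exists (econj t); exact: econjM. Qed.

Lemma nearest_int (u n : int) : 0 < n ->
  exists q : int, 2 * `|u - q * n| <= n.
Proof.
move=> n0; have nn0 : n != 0 by lia.
have /= m0 := modz_ge0 u nn0; have m1 := ltz_pmod u n0.
have uE := divz_eq u n.
have [h|h] := leP (2 * (u %% n)%Z) n.
- exists (u %/ n)%Z.
  have -> : u - (u %/ n)%Z * n = (u %% n)%Z by lia.
  lia.
- exists ((u %/ n)%Z + 1).
  have -> : u - ((u %/ n)%Z + 1) * n = (u %% n)%Z - n by lia.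
  lia.
Qed.

Lemma enorm_half x n : 2 * `|x.1| <= n -> 2 * `|x.2| <= n ->
  4 * enorm x <= 3 * n ^+ 2.
Proof.
case: x => a b /=; rewrite /enorm /= => ha hb.
have : - n <= 2 * a <= n by lia.
have : - n <= 2 * b <= n by lia.
clear; nia.
Qed.

(* Round the coordinates of [x * econj y / enorm y] to nearest integers; the
   remainder then has norm at most [3/4 * enorm y]. *)
Lemma eeuclid x y : y <> 0 -> exists q, enorm (x - q * y) < enorm y.
Proof.
move=> y0; have n0 : 0 < enorm y.
  by rewrite lt_neqAle enorm_ge0 andbT eq_sym; apply/eqP => /enorm_eq0.
have [q1 h1] := nearest_int (x * econj y).1 n0.
have [q2 h2] := nearest_int (x * econj y).2 n0.
exists (q1, q2); set q : eisenstein := (q1, q2).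
have E : (x - q * y) * econj y =
  ((x * econj y).1 - q1 * enorm y, (x * econj y).2 - q2 * enorm y).
  rewrite mulrBl -mulrA emul_conj einjE [X in _ - X]emulE /=.
  by congr pair; rewrite /=; ring.
have := @enorm_half (_, _) _ h1 h2; rewrite -E enormM enorm_conj.
have := enorm_ge0 (x - q * y); move: (enorm _) (enorm _) n0 => N M; nia.
Qed.

Lemma enorm_min (P : eisenstein -> Prop) : (exists x, P x) ->
  exists2 x, P x & forall y, P y -> enorm x <= enorm y.
Proof.
move=> [x0 Px0].
have ex : exists k : nat, `[< exists2 x, P x & enorm x = k%:Z >].
  exists `|enorm x0|%N; apply/asboolP; exists x0 => //.
  by rewrite gez0_abs // enorm_ge0.
case: (ex_minnP ex) => k /asboolP [x Px xk] kmin.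
exists x => // y Py; rewrite xk -(gez0_abs (enorm_ge0 y)) lez_nat.
apply: kmin; apply/asboolP; exists y => //.
by rewrite gez0_abs // enorm_ge0.
Qed.

Definition eprime p : Prop := 1 < enorm p /\
  forall x y, edvd p (x * y) -> edvd p x \/ edvd p y.

Lemma enorm_ge1 x : x <> 0 -> 1 <= enorm x.
Proof.
move=> x0; rewrite -gtz0_ge1 lt_neqAle enorm_ge0 andbT eq_sym.
by apply/eqP => /enorm_eq0.
Qed.

(* A non-unit divisor of [z] of least norm is prime: a generator [d] of the
   ideal [(p, x)] is then either a unit or an associate of [p]. *)
Lemma eprime_divisor z : 1 < enorm z -> exists2 p, eprime p & edvd p z.
Proof.
move=> z1.
have [|p [p1 pz] pmin] :=
  @enorm_min (fun p => 1 < enorm p /\ edvd p z).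
  by exists z; split=> //; exists 1; rewrite mulr1.
exists p => //; split=> // x y pxy.
have p0 : p <> 0 by move=> p0; move: p1; rewrite p0.
pose I d := d <> 0 /\ exists a b, d = a * p + b * x.
have [|d [d0 [a [b dE]]] dmin] := @enorm_min I.
  by exists p; split=> //; exists 1, 0; rewrite mul0r mul1r addr0.
(* The remainder of [t] modulo [d] stays in the ideal, so minimality of [d] forces it to vanish. *)
have dI t : (exists a b, t = a * p + b * x) -> edvd d t.
  move=> [s1 [s2 tE]]; have [q qlt] := eeuclid t d0.
  exists q; apply/eqP; rewrite -subr_eq0 mulrC; apply/eqP.
  apply: contrapT => r0; suff /dmin : I (t - q * d) by rewrite leNgt qlt.
  split=> //; exists (s1 - q * a), (s2 - q * b).
  by rewrite tE dE; ring.
have [e pE] : edvd d p by apply: dI; exists 1, 0; ring.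
have dx : edvd d x by apply: dI; exists 0, 1; ring.
have d1 := enorm_ge1 d0.
have [dle|dgt] := leP (enorm d) 1.
  (* The relation for [d], times the conjugate of the unit [d], expresses 1, hence [y], through [p]
     and [x]. *)
  right; have du : enorm d = 1 by lia.
  have -> : y = p * (a * econj d * y) + b * econj d * (x * y).
    rewrite -[LHS]mul1r -[1]/(1%:~R) -du -emul_conj {1}dE; ring.
  apply: edvdD; last exact: edvd_mull.
  by exists (a * econj d * y).
left; apply: edvd_trans dx; exists (econj e).
(* [d] is a non-unit divisor of [z], so minimality of [p] makes the cofactor [e] a unit. *)
have dp : enorm p <= enorm d.
  by apply: pmin; split=> //; apply: edvd_trans pz; exists e.
have e1 : enorm e = 1.
  move: dp p1; rewrite pE enormM.
  have := enorm_ge0 e; move: (enorm d) (enorm e) dgt; nia.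
by rewrite pE -mulrA emul_conj e1 mulr1.
Qed.

(** * Power sums over the shells *)

Definition eshell n : set eisenstein := [set z | enorm z = n].

Definition epower_sum n : eisenstein := \sum_(z \in eshell n) z ^+ 6.

Lemma finite_eshell n : finite_set (eshell n).
Proof.
have [n0|n0] := ltP n 0.
  rewrite (_ : eshell n = set0) // -subset0 => z zn.
  by move: n0; rewrite -zn ltNge enorm_ge0.
(* The image of [I_N] under [f] is the interval from [-2n] to [2n], which contains both
   coordinates. *)
pose N := (absz (4 * n)).+1.
pose f (k : nat) : int := k%:Z - n - n.
have fA : finite_set (f @` `I_N) by exact/finite_image/finite_II.
apply: sub_finite_set (finite_setX fA fA) => -[a b] /=.
have fE c : - n <= c + n -> c <= n + n -> (f @` `I_N) c.
  move=> h1 h2; exists (absz (c + n + n)) => /=; first by rewrite /N; lia.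
  by rewrite /f; lia.
rewrite /eshell /= /enorm /= => h.
(* Since [4 (a ^ 2 + a b + b ^ 2) = 3 a ^ 2 + (2 b + a) ^ 2], and symmetrically. *)
have ha : 3 * (a * a) <= 4 * n by have := sqr_ge0 (2 * b + a); nia.
have hb : 3 * (b * b) <= 4 * n by have := sqr_ge0 (2 * a + b); nia.
by move: ha hb; clear h; split; apply: fE; nia.
Qed.

(** Multiplication by [p] is a bijection from the shell of norm [n] onto the set summed over on the
    left. *)
Lemma epower_sum_dvd p n : p <> 0 ->
  \sum_(z \in eshell (enorm p * n) `&` edvd p) z ^+ 6 =
    p ^+ 6 * epower_sum n.
Proof.
move=> p0; rewrite /epower_sum fsbig_distrr; last exact: finite_eshell.
under [RHS]eq_fsbigr do rewrite /= -exprMn.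
rewrite -(fsbig_image (eshell n) ( *%R p) (fun z => z ^+ 6));
  last by move=> x y _ _; exact: emulfI.
apply: eq_fsbigl; apply/seteqP; split=> z /=.
  move=> [+ [w zw]]; rewrite zw /eshell /= enormM => h; exists w => //=.
  by apply: mulfI h; apply/eqP => /enorm_eq0.
by move=> [w <- <-]; rewrite /eshell /= enormM; split=> //; exists w.
Qed.

Lemma eprime_neq0 p : eprime p -> p <> 0.
Proof. by move=> [p1 _] p0; move: p1; rewrite p0. Qed.

Lemma eprime_dvdX p x k : eprime p -> edvd p (x ^+ k) -> edvd p x.
Proof.
move=> [p1 pP]; elim: k => [[t /(congr1 enorm)]|k IH].
  rewrite expr0 enormM enorm1 => h; exfalso; move: h p1 (enorm_ge0 t).
  move: (enorm p) (enorm t) => a b ab a1; rewrite le_eqVlt => /orP [/eqP b0|b0].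
    by rewrite -b0 mulr0 in ab.
  by nia.
by rewrite exprS => /pP [].
Qed.

Lemma eprime_dvd_norm p z n : eprime p -> enorm z = enorm p * n ->
  edvd p z \/ edvd (econj p) z.
Proof.
move=> [p1 pP] zn; have /pP [] : edvd p (z * econj z).
- exists (econj p * n%:~R).
  by rewrite emul_conj zn mulrA emul_conj intrM.
- by left.
- by move/edvd_conj; rewrite econjK; right.
Qed.

(** An element of norm divisible by [enorm p] that is not a multiple of [p] is a multiple of
    [econj p], and the quotient is still not a multiple of [p]: the [k] factors [econj p] come off
    one by one. *)
Lemma eshell_ndvd p n k : eprime p -> ~ edvd p (econj p) ->
  (forall z, enorm z = n -> ~ edvd p z) ->
  eshell (enorm p ^+ k * n) `\` edvd p =
    *%R (econj p ^+ k) @` eshell n.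
Proof.
move=> pp pc pn; have pP := pp.2; apply/seteqP; split=> z /=; last first.
  move=> [w wn <-]; rewrite /eshell /= enormM enormX enorm_conj wn; split=> //.
  by move=> /pP [/(eprime_dvdX pp)|] //; exact: pn.
elim: k z => [|k IH] z.
  by rewrite expr0 mul1r => -[zn _]; exists z => //; rewrite mul1r.
move=> [zn npz]; rewrite /eshell /= exprS -mulrA in zn.
have [//|[w zE]] := eprime_dvd_norm pp zn.
have [|v vn vE] := IH w.
  split; last by move=> pw; apply: npz; rewrite zE; exact: edvd_mull.
  apply: (@mulfI _ (enorm p)).
    by apply/eqP => /enorm_eq0 /(eprime_neq0 pp).
  by rewrite -zn zE enormM enorm_conj.
by exists v => //; rewrite zE -vE mulrA -exprS.
Qed.

Lemma epower_sum_recurrence p n k : eprime p -> ~ edvd p (econj p) ->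
  (forall z, enorm z = n -> ~ edvd p z) ->
  epower_sum (enorm p ^+ k.+1 * n) =
    p ^+ 6 * epower_sum (enorm p ^+ k * n) +
    (econj p ^+ 6) ^+ k.+1 * epower_sum n.
Proof.
move=> pp pc pn; have p0 := eprime_neq0 pp.
rewrite {1}/epower_sum (fsbigID (edvd p)); last exact: finite_eshell.
congr (_ + _); first by rewrite exprS -mulrA epower_sum_dvd.
rewrite -setDE eshell_ndvd // fsbig_image; last first.
  move=> x y _ _; apply: emulfI => /(congr1 enorm) /eqP.
  rewrite enormX enorm_conj expf_eq0 /= => /eqP /enorm_eq0; exact: p0.
rewrite /epower_sum fsbig_distrr; last exact: finite_eshell.
by apply: eq_fsbigr => z _; rewrite exprMn exprAC.
Qed.

Lemma epower_sum_prime_power p n k : eprime p -> ~ edvd p (econj p) ->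
  (forall z, enorm z = n -> ~ edvd p z) ->
  exists2 a, ~ edvd p a & epower_sum (enorm p ^+ k * n) = a * epower_sum n.
Proof.
move=> pp pc pn.
suff [a [b aE] ->] : exists2 a, edvd p (a - (econj p ^+ 6) ^+ k) &
    epower_sum (enorm p ^+ k * n) = a * epower_sum n.
  (* If [p] divided [a], it would divide [econj p ^ (6 k)], hence [econj p]. *)
  exists a => // pa; apply: pc; apply: (@eprime_dvdX _ _ (6 * k)) => //.
  rewrite exprM; have -> : (econj p ^+ 6) ^+ k = a + p * (- b).
    by rewrite mulrN -aE; ring.
  by apply: edvdD pa _; exists (- b).
elim: k => [|k [a [b aE] IH]].
  by exists 1; [exists 0; rewrite expr0; ring | rewrite expr0 !mul1r].
exists (p ^+ 6 * a + (econj p ^+ 6) ^+ k.+1).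
  by exists (p ^+ 5 * a); ring.
by rewrite epower_sum_recurrence // IH; ring.
Qed.

(** Descent on the norm: the factor [p] may be removed from any element of the same norm, so [w]
    need not divide [z]. *)
Lemma eprime_norm_decomposition p z : eprime p -> z <> 0 ->
  exists k w, [/\ w <> 0, enorm z = enorm p ^+ k * enorm w &
    forall x, enorm x = enorm w -> ~ edvd p x].
Proof.
move=> pp; have [m] := ubnP `|enorm z|%N; elim: m z => // m IH z zm z0.
have [h|/existsNP [x /not_implyP [xz /contrapT [v xE]]]] :=
  pselect (forall x, enorm x = enorm z -> ~ edvd p x).
  by exists 0%N, z; rewrite expr0 mul1r.
have zE : enorm z = enorm p * enorm v by rewrite -xz xE enormM.
have v0 : v <> 0.
  by move=> v0; move: zE; rewrite v0 mulr0 => /enorm_eq0.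
have [|//|k [w [w0 vE wP]]] := IH v.
  have := enorm_ge1 v0; have := pp.1; move: zm; rewrite zE; nia.
by exists k.+1, w; split=> //; rewrite zE vE exprS mulrA.
Qed.

Lemma eunit_expr6 z : enorm z = 1 -> z ^+ 6 = 1.
Proof.
case: z => a b; rewrite /enorm /= => h.
have : [|| (a == 1) && (b == 0), (a == 0) && (b == 1), (a == -1) && (b == 1),
   (a == -1) && (b == 0), (a == 0) && (b == -1) | (a == 1) && (b == -1)] by nia.
by do 5?[case/orP]; case/andP => /eqP -> /eqP ->; apply/eqP.
Qed.

(** Every term is 1, so the sum counts the units; setting the unit 1 apart shows that the count is
    positive without enumerating them. *)
Lemma epower_sum1 : epower_sum 1 <> 0.
Proof.
rewrite /epower_sum (eq_fsbigr (fun=> 1)); last first.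
  by move=> z /set_mem; exact: eunit_expr6.
rewrite (fsbigD1 1); [|exact: finite_eshell|by []].
rewrite fsbig_finite; last exact/finite_setD/finite_eshell.
rewrite big_const_seq iter_addr_0 /= -mulrS pmulrn => /(congr1 enorm).
by rewrite einjE /enorm /=; lia.
Qed.

Lemma epower_sum_neq0 z : z <> 0 -> epower_sum (enorm z) <> 0.
Proof.
have [m] := ubnP `|enorm z|%N; elim: m z => // m IH z zm z0.
have z1 := enorm_ge1 z0.
have [zu|z_gt1] := leP (enorm z) 1.
  have -> : enorm z = 1 by lia.
  exact: epower_sum1.
have [p pp [v zE]] := eprime_divisor z_gt1.
have p1 := pp.1; have p0 := eprime_neq0 pp.
have [pc|pc] := pselect (edvd p (econj p)).
  have v0 : v <> 0 by move=> v0; apply: z0; rewrite zE v0 mulr0.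
  (* Each element of the shell is a multiple of [p] or of [econj p], hence of [p] in both cases. *)
  have -> : epower_sum (enorm z) = p ^+ 6 * epower_sum (enorm v).
    rewrite -epower_sum_dvd // -enormM -zE; apply: eq_fsbigl.
    apply/seteqP; split=> x /=; last by case.
    rewrite /eshell /= => xz; split=> //.
    have [|//|cpx] := @eprime_dvd_norm p x (enorm v) pp.
      by rewrite xz zE enormM.
    exact: edvd_trans pc cpx.
  move/emulf_eq0 => [/(congr1 enorm)/eqP|].
    by rewrite enormX expf_eq0 /= => /eqP /enorm_eq0.
  apply: IH => //; have := enorm_ge1 v0; move: zm; rewrite zE enormM; nia.
have [k [w [w0 zwE wP]]] := eprime_norm_decomposition pp z0.
have [a pa] := epower_sum_prime_power k pp pc wP.
rewrite zwE => -> /emulf_eq0 [a0|].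
  by apply: pa; exists 0; rewrite a0 mulr0.
(* If [k = 0], then [z] has the norm of [w] and is a multiple of [p], against [wP]; so the norm
   strictly decreases. *)
apply: IH => //; case: k zwE => [|k] zwE.
  case: (wP z); last by exists v.
  by rewrite zwE expr0 mul1r.
have w1 := enorm_ge1 w0.
suff : enorm w < enorm z by lia.
by rewrite zwE ltr_pMl ?(lt_le_trans _ w1) // exprn_egt1.
Qed.

(** * The degree-six harmonic polynomial *)

(* [hex6 a b] is the trace of [(a + b * zeta) ^ 6]: with [t = 2 a + b] and
   [n = a ^ 2 + a b + b ^ 2] the trace and norm of [a + b * zeta], and
   [w = t ^ 2 - 2 n], it equals [w ^ 3 - 3 n ^ 2 w]. *)
Definition hex6 (T : comNzRingType) (a b : T) : T :=
  let n := a * a + a * b + b * b in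
  let w := (a * a + a * b) *+ 2 - b * b in
  w * w * w - (n * n * w) *+ 3.

(** Serves both for the evaluation of polynomials and for the embedding of the integers in [R]. *)
Lemma rmorph_hex6 (S T : comNzRingType) (g : {rmorphism S -> T}) (a b : S) :
  g (hex6 a b) = hex6 (g a) (g b).
Proof. by rewrite /hex6 !(rmorphB, rmorphMn, rmorphM, rmorphD). Qed.

Definition etrace (z : eisenstein) : int := 2 * z.1 + z.2.

Lemma etrace_expr6 z : etrace (z ^+ 6) = hex6 z.1 z.2.
Proof. by rewrite !exprS expr0 mulr1 /etrace /hex6 /=; ring. Qed.

(** Conjugation permutes each shell. *)
Lemma econj_epower_sum n : econj (epower_sum n) = epower_sum n.
Proof.
have econjD : {morph econj : x y / x + y}.
  by move=> x y; rewrite /econj /=; congr pair; rewrite /=; ring.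
rewrite /epower_sum !fsbig_finite; [|exact: finite_eshell..].
rewrite (big_morph _ econjD (erefl : econj 0 = 0)) -!fsbig_finite;
  [|exact: finite_eshell..].
have {2}-> : eshell n = econj @` eshell n.
  apply/seteqP; split=> z /=.
    move=> zn; exists (econj z); last exact: econjK.
    by rewrite /= /eshell /= enorm_conj.
  by move=> [w wn <-]; rewrite /eshell /= enorm_conj.
rewrite fsbig_image; last by move=> x y _ _; exact: (inv_inj econjK).
by apply: eq_fsbigr => z _; exact: econjX.
Qed.

(** Being fixed by conjugation, the power sum has second coordinate 0, so its trace is twice its
    first coordinate. *)
Lemma etrace_epower_sum_neq0 z : z <> 0 -> etrace (epower_sum (enorm z)) <> 0.
Proof.
move/epower_sum_neq0; have := econj_epower_sum (enorm z).
case: (epower_sum _) => a b [_ h2]; rewrite /etrace /= => n0 h1; apply: n0.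
by congr pair; lia.
Qed.

(** The witness is [hex6] computed in the polynomial ring itself; it is homogeneous of degree 6. *)
Lemma polynomial_function_hex6 (R : realType) (V : set 'rV[R]_3) :
  polynomial_function V 7 (fun v : 'rV[R]_3 => hex6 (v 0 0) (v 0 1)).
Proof.
pose X (i : 'I_3) : mpoly 3 R := mpolyX R (mnm1 i).
exists (hex6 (X 0) (X 1)); last first.
  by move=> x _; rewrite rmorph_hex6 /= !mevalXU.
have X1 i : X i \is ishomog1 1 mdeg by rewrite dhomogX /= mdeg1.
have X2 i j : X i * X j \is ishomog1 2 mdeg by exact: (@dhomogM _ _ _ 1 _ 1).
have h6 : hex6 (X 0) (X 1) \is ishomog1 6 mdeg.
  rewrite /hex6; set n := _ + _ + _; set w := _ *+ 2 - _.
  have n2 : n \is ishomog1 2 mdeg by do 2?[apply: rpredD].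
  have w2 : w \is ishomog1 2 mdeg.
    by apply: rpredB => //; apply: rpredMn; apply: rpredD.
  apply: rpredB; last apply: rpredMn.
    by apply: (@dhomogM _ _ _ 4 _ 2) => //; exact: (@dhomogM _ _ _ 2 _ 2).
  by apply: (@dhomogM _ _ _ 4 _ 2) => //; exact: (@dhomogM _ _ _ 2 _ 2).
by move=> k /(dhomog_mf h6) ->.
Qed.

(** * Integrals over circles *)

Lemma Rintegral_derive (R : realType) (F f : R -> R) (a b : R) : a < b ->
  (forall s : R, is_derive s 1 F (f s)) -> continuous f ->
  \int[lebesgue_measure]_(s in `[a, b]) f s = F b - F a.
Proof.
move=> ab dF cf; have cF : continuous F.
  move=> s; apply: differentiable_continuous; apply/derivable1_diffP.
  by case: (dF s).
rewrite /Rintegral (@continuous_FTC2 _ f F a b) //.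
- exact/continuous_subspaceT.
- split; first by move=> s _; case: (dF s).
  + by apply: cvg_at_right_filter; exact: cF.
  + by apply: cvg_at_left_filter; exact: cF.
- by move=> s _; rewrite derive1E; case: (dF s).
Qed.

Lemma speed_circle_param (R : realType) (k : nat) (u v : 'rV[R]_k) (r s : R) :
  dot u u = 1 -> dot v v = 1 -> dot u v = 0 -> 0 < r ->
  speed (circle_param u v r) s = r.
Proof.
move=> uu vv uv r0; rewrite /speed.
have dE i : derive1 (fun t : R => circle_param u v r t 0 i) s =
    r * cos s * v 0 i - r * sin s * u 0 i.
  rewrite derive1E; apply: derive_val.
  under eq_fun do rewrite !mxE.
  apply: is_derive_eq.
  by rewrite /GRing.scale /=; ring.
under eq_bigr do rewrite dE.
have -> : \sum_(i < k) (r * cos s * v 0 i - r * sin s * u 0 i) ^+ 2 =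
  (r * cos s) ^+ 2 * dot v v + (r * sin s) ^+ 2 * dot u u
    - 2 * (r * cos s) * (r * sin s) * dot u v.
  rewrite /dot !mulr_sumr -sumrN -!big_split /=.
  by apply: eq_bigr => i _; ring.
rewrite uu vv uv mulr0 subr0 !mulr1 !exprMn -mulrDr cos2Dsin2 mulr1.
by rewrite sqrtr_sqr gtr0_norm.
Qed.

(* The integrand is [cos (6 s)] and the antiderivative [sin (6 s) / 6], as
   polynomials in [cos s] and [sin s]. *)
Lemma Rintegral_cos6 (R : realType) (c : R) :
  \int[lebesgue_measure]_(s in `[(0 : R), 2 * pi])
    (c * (cos s ^+ 6 - 15 * cos s ^+ 4 * sin s ^+ 2
          + 15 * cos s ^+ 2 * sin s ^+ 4 - sin s ^+ 6)) = 0.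
Proof.
pose F (s : R) := c * (cos s ^+ 5 * sin s - 10 / 3 * (cos s ^+ 3 * sin s ^+ 3)
  + cos s * sin s ^+ 5).
have dF (s : R) : is_derive s 1 F
    (c * (cos s ^+ 6 - 15 * cos s ^+ 4 * sin s ^+ 2
    + 15 * cos s ^+ 2 * sin s ^+ 4 - sin s ^+ 6)).
  by rewrite /F; apply: is_derive_eq; rewrite /GRing.scale /=; field.
rewrite (Rintegral_derive _ dF).
- by rewrite /F sin0 mulr_natl sin2pi !expr0n /= !(mulr0, subr0, addr0).
- by rewrite mulr_gt0 // pi_gt0.
- move=> s.
  have cc := @continuous_cos R s; have cs := @continuous_sin R s.
  by repeat first [exact: cvg_cst | exact: cc | exact: cs | apply: cvgM
    | apply: cvgB | apply: cvgD | apply: cvgX].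
Qed.

(** * Shells of the hexagonal lattice *)

Lemma sum3E (T : zmodType) (F : 'I_3 -> T) : \sum_i F i = F 0 + F 1 + F 2%:R.
Proof.
rewrite !big_ord_recr big_ord0 /= add0r.
by congr (F _ + F _ + F _); exact: val_inj.
Qed.

(** The third entry is the default value of [nth], reached at index 2. *)
Definition row3 (T : Type) (a b c : T) : 'rV[T]_3 :=
  \row_i nth c [:: a; b] i.

Lemma row3E (T : Type) (a b c : T) :
  (row3 a b c 0 0 = a) * (row3 a b c 0 1 = b) * (row3 a b c 0 2%:R = c).
Proof. by rewrite /row3 !mxE. Qed.

Lemma row3P (T : Type) (v w : 'rV[T]_3) :
  v 0 0 = w 0 0 -> v 0 1 = w 0 1 -> v 0 2%:R = w 0 2%:R -> v = w.
Proof.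
move=> h0 h1 h2; apply/rowP => -[[|[|[|//]]] hi].
- by rewrite (_ : Ordinal hi = 0) //; exact: val_inj.
- by rewrite (_ : Ordinal hi = 1) //; exact: val_inj.
- by rewrite (_ : Ordinal hi = 2%:R) //; exact: val_inj.
Qed.

(* The isometry, up to the factor [sqrt 2], from the Eisenstein integers onto
   [A2]. *)
Definition A2_point (R : realType) z : 'rV[R]_3 :=
  row3 z.1%:~R z.2%:~R (- (z.1 + z.2)%:~R).

Lemma dot_A2_point (R : realType) z :
  dot (A2_point R z) (A2_point R z) = (2 * enorm z)%:~R.
Proof.
rewrite /dot sum3E !row3E /enorm !(intrM, intrD, rmorphXn) /=; ring.
Qed.

Lemma A2_point_inj (R : realType) : injective (A2_point R).
Proof.
move=> [a b] [c d] h; have := congr1 (fun v : 'rV[R]_3 => v 0 0) h.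
have := congr1 (fun v : 'rV[R]_3 => v 0 1) h.
by rewrite !row3E /= => /intr_inj -> /intr_inj ->.
Qed.

Lemma A2_shellP (R : realType) (m : R) (v : 'rV[R]_3) :
  A2_shell m v <-> exists2 z, v = A2_point R z & (2 * enorm z)%:~R = m.
Proof.
split=> [[[k /= k0 <-] km]|[z -> zm]]; last first.
  split; last by rewrite dot_A2_point.
  exists (row3 z.1 z.2 (- (z.1 + z.2))); first by rewrite /= sum3E !row3E; ring.
  by apply: row3P; rewrite !mxE //= rmorphN.
have kE : map_mx intr k = A2_point R (k 0 0, k 0 1).
  move: k0; rewrite sum3E => k0.
  apply: row3P; rewrite row3E mxE //= -rmorphN; congr (_%:~R); lia.
by exists (k 0 0, k 0 1); rewrite // -dot_A2_point -kE.
Qed.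

Lemma A2_shell_image (R : realType) z :
  A2_shell (2 * enorm z)%:~R = A2_point R @` eshell (enorm z).
Proof.
apply/seteqP; split=> v.
  move=> /A2_shellP [x -> /intr_inj xz]; exists x => //.
  by rewrite /eshell /=; lia.
by move=> [x xz <-]; apply/A2_shellP; exists x => //; rewrite xz.
Qed.

Lemma sum_hex6_A2_shell (R : realType) z :
  \sum_(v \in A2_shell (2 * enorm z)%:~R) hex6 (v 0 0 : R) (v 0 1) =
  (etrace (epower_sum (enorm z)))%:~R.
Proof.
rewrite A2_shell_image fsbig_image; last first.
  by move=> x y _ _; exact: A2_point_inj.
have trD : {morph (fun x => (etrace x)%:~R : R) : x y / x + y}.
  by move=> x y; rewrite -intrD; congr (_%:~R); rewrite /etrace /=; ring.
rewrite /epower_sum !fsbig_finite; [|exact: finite_eshell..].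
rewrite (big_morph _ trD (erefl : (etrace 0)%:~R = 0 :> R)).
by apply: eq_bigr => x _; rewrite !row3E -rmorph_hex6 etrace_expr6.
Qed.

(** For positive [a] and [b], these are (1, 0, -1) / sqrt 2 and (-1, 2, -1) / sqrt 6; giving only
    the squares keeps roots out of the computations. *)
Lemma A2_plane_basis (R : realType) (a b : R) :
  2 * a ^+ 2 = 1 -> 6 * b ^+ 2 = 1 ->
  orthonormal_basis2 (@A2_plane R) (row3 a 0 (- a)) (row3 (- b) (2 * b) (- b)).
Proof.
move=> ha hb; have a0 : a != 0.
  by apply/eqP => a0; move: ha; rewrite a0 expr0n mulr0; lra.
have b0 : b != 0.
  by apply/eqP => b0; move: hb; rewrite b0 expr0n mulr0; lra.
split; rewrite /dot ?sum3E ?row3E; [lra|lra|ring|].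
apply/seteqP; split=> v; rewrite /A2_plane /= sum3E.
  move=> v0; exists ((v 0 0 + v 0 1 / 2) / a), (v 0 1 / (2 * b)).
  have v2 : v 0 2%:R = - v 0 0 - v 0 1.
    by apply/eqP; rewrite -subr_eq0 -v0; apply/eqP; ring.
  by apply: row3P; rewrite !mxE /= ?v2; field; rewrite ?a0 ?b0.
by move=> [s [t ->]]; rewrite !mxE /=; ring.
Qed.

Lemma circle_integral_hex6 (R : realType) (a b r : R) : 0 < r ->
  2 * a ^+ 2 = 1 -> 6 * b ^+ 2 = 1 ->
  circle_integral (row3 a 0 (- a)) (row3 (- b) (2 * b) (- b)) r
    (fun v => hex6 (v 0 0) (v 0 1)) = 0.
Proof.
move=> r0 ha hb; have [uu vv uv _] := A2_plane_basis ha hb.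
rewrite /circle_integral /arclength_integral.
(* With [n = r ^ 2 / 2] and [w = r ^ 2 cos (2 s)], the triple angle formula gives
   [w ^ 3 - 3 n ^ 2 w = r ^ 6 cos (6 s) / 4]; the speed contributes one more factor [r]. *)
rewrite -[RHS](Rintegral_cos6 (r ^+ 7 / 4)).
apply: eq_Rintegral => s _; rewrite (speed_circle_param _ uu vv uv r0).
have -> : circle_param (row3 a 0 (- a)) (row3 (- b) (2 * b) (- b)) r s 0 0 =
    r * (a * cos s - b * sin s) by rewrite !mxE /=; ring.
have -> : circle_param (row3 a 0 (- a)) (row3 (- b) (2 * b) (- b)) r s 0 1 =
    r * (2 * b * sin s) by rewrite !mxE /=; ring.
move: (cos s) (sin s) => C S; rewrite /hex6.
set x0 := r * _; set x1 := r * _.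
have a2 : a ^+ 2 = 1 / 2 by lra.
have b2 : b ^+ 2 = 1 / 6 by lra.
have -> : x0 * x0 + x0 * x1 + x1 * x1 = r ^+ 2 / 2 * (C ^+ 2 + S ^+ 2).
  have -> : x0 * x0 + x0 * x1 + x1 * x1 =
    r ^+ 2 * (a ^+ 2 * C ^+ 2 + 3 * b ^+ 2 * S ^+ 2) by rewrite /x0 /x1; ring.
  by rewrite a2 b2; field.
have -> : (x0 * x0 + x0 * x1) *+ 2 - x1 * x1 = r ^+ 2 * (C ^+ 2 - S ^+ 2).
  have -> : (x0 * x0 + x0 * x1) *+ 2 - x1 * x1 =
    r ^+ 2 * (2 * a ^+ 2 * C ^+ 2 - 6 * b ^+ 2 * S ^+ 2).
    by rewrite /x0 /x1; ring.
  by rewrite ha hb; ring.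
by field.
Qed.

Theorem theorem1p3 (R : realType) (m : R) (hm : 0 < m)
    (hne : A2_shell m !=set0) :
  ~ spherical_design (@A2_plane R) 7 (A2_shell m).
Proof.
move=> [fin _ [r [r0 _ des]]].
have [v /A2_shellP [z _ zm]] := hne.
have z0 : z <> 0.
  by move=> z0; move: hm; rewrite -zm z0 mulr0 ltxx.
pose a : R := Num.sqrt (2^-1); pose b : R := Num.sqrt (6^-1).
have ha : 2 * a ^+ 2 = 1.
  by rewrite sqr_sqrtr ?invr_ge0 ?ler0n // mulfV // pnatr_eq0.
have hb : 6 * b ^+ 2 = 1.
  by rewrite sqr_sqrtr ?invr_ge0 ?ler0n // mulfV // pnatr_eq0.
have := des _ _ (A2_plane_basis ha hb) _ (polynomial_function_hex6 _).
rewrite circle_integral_hex6 // mulr0 => /eqP; rewrite mulf_eq0 invr_eq0.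
rewrite pnatr_eq0 cardfs_eq0 => /orP [/eqP s0|].
  (* [fset_set] is empty by default on infinite sets, so finiteness is needed to conclude that the
     shell would be empty. *)
  have := fset_setK fin; rewrite s0 => s1.
  by move: hne => -[t]; rewrite -s1.
rewrite -zm sum_hex6_A2_shell intr_eq0 => /eqP.
exact: etrace_epower_sum_neq0.
Qed.
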